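(* Let $X$ be an infinite set, and let $S$ be a monoid such that $\mathrm{Sym}_X\leq S\leq \mathrm{Inj}_X$ (i.e. $S$ is a submonoid of $\mathrm{Inj}_X$ containing $\mathrm{Sym}_X$). Then the following are equivalent: (1) $\omega_S^r$ is finitely generated and $D_r(S)=4$; (2) $\omega_S^r$ is finitely generated; (3) $S\cap \mathrm{BL}_X\neq\emptyset$; (4) $S$ contains $\mathrm{BL}_X$. Consequently, the monoids $\mathrm{Sym}_X\cup \mathrm{BL}_X$ and $\mathrm{Inj}_X$ have right diameter $4$.
   Context: Maps are written on the right and composed from left to right. $\mathrm{Sym}_X$ is the symmetric group on $X$ (all bijections $X\to X$); $\mathrm{Inj}_X$ is the monoid of all injective maps $X\to X$; $\mathrm{BL}_X=\{\alpha\in \mathrm{Inj}_X : |X\setminus \operatorname{im}\alpha|=|X|\}$ is the Baer-Levi semigroup. For a semigroup $S$, $S^1$ is $S$ with an identity adjoined if $S$ has none ($S^1=S$ if $S$ is a monoid). A right congruence on $S$ is an equivalence relation $\rho$ such that $(a,b)\in\rho$ implies $(as,bs)\in\rho$ for all $s\in S$; $\langle U\rangle$ denotes the smallest right congruence containing $U\subseteq S\times S$. The universal relation $S\times S$ viewed as a right congruence is denoted $\omega_S^r$; it is finitely generated if $\omega_S^r=\langle U\rangle$ for some finite $U\subseteq S\times S$. A $U$-sequence of length $n\geq 1$ from $a$ to $b$ is a sequence $a=u_1s_1,\ v_1s_1=u_2s_2,\ \dots,\ v_ns_n=b$ where, for each $i$, $(u_i,v_i)\in U$ or $(v_i,u_i)\in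 U$, and $s_i\in S^1$; if $a=b$ then $a,b$ are related by a $U$-sequence of length $0$. If $\omega_S^r=\langle U\rangle$, let $d_U^r(a,b)$ be the least length of a $U$-sequence from $a$ to $b$ and $D_r(U,S)=\sup\{d_U^r(a,b):a,b\in S\}$. If $\omega_S^r$ is finitely generated, the right diameter of $S$ is $D_r(S)=\min\{D_r(U,S): \omega_S^r=\langle U\rangle,\ U\text{ finite}\}$. Saying ''$S$ has right diameter $n$'' means $\omega_S^r$ is finitely generated and $D_r(S)=n$. *)

(* Defs.v *)
From HB Require Import structures.
From mathcomp Require Import all_boot all_order.
From mathcomp Require Import boolp classical_sets functions cardinality.

Set Implicit Arguments.
Unset Strict Implicit.
Unset Printing Implicit Defensive.

Import Order.TTheory.

Local Open Scope classical_set_scope.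
Local Open Scope card_scope.

Section RightDiameter.
Local Open Scope group_scope.
Variable S : semigroupType.
Implicit Types (U : set (S * S)) (rho : S -> S -> Prop) (a b : S).

Definition right_congruence rho : Prop :=
  RelationClasses.Equivalence rho /\
  (forall a b s, rho a b -> rho (a * s) (b * s)).

Definition right_congruence_gen U : S -> S -> Prop := fun a b =>
  forall rho, right_congruence rho ->
    (forall u v, U (u, v) -> rho u v) -> rho a b.

Definition generates_universal U : Prop :=
  forall a b, right_congruence_gen U a b.

Definition universal_fin_gen : Prop :=
  exists U, finite_set U /\ generates_universal U.

(* [option S] plays the role of S^1, with [None] acting as the adjoined        *)
(* identity. If S already has an identity 1, then [None] and [Some 1] act in   *)
(* the same way on S, so that this agrees with the convention S^1 = S.         *)
Definition act1 a (s : option S) : S := if s is Some t then a * t else a.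

Definition ustep U a b : Prop :=
  exists (u v : S) (s : option S),
    [/\ U (u, v) \/ U (v, u), a = act1 u s & act1 v s = b].

Fixpoint useq U (n : nat) a b : Prop :=
  if n is m.+1 then exists c, ustep U a c /\ useq U m c b else a = b.

Definition is_minimum (A : set nat) (n : nat) : Prop := A n /\ lbound A n.

Definition right_dist U a b (n : nat) : Prop :=
  is_minimum [set k | useq U k a b] n.

(* D_r(U, S) = n with n finite; when the supremum is infinite, this holds for  *)
(* no n, and such a U is irrelevant to a finite minimum over U below.          *)
Definition right_diameter_wrt U (n : nat) : Prop :=
  supremums [set k | exists a b, right_dist U a b k] n.

Definition right_diameter (n : nat) : Prop :=
  is_minimum
    [set k | exists U,
       [/\ finite_set U, generates_universal U & right_diameter_wrt U k]] n.

Definition has_right_diameter (n : nat) : Prop :=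
  universal_fin_gen /\ right_diameter n.

End RightDiameter.

Section Submonoid.
Variables (M : monoidType) (S : umagmaClosed M).

Record submonoid : Type := Submonoid {
  submonoid_val :> M;
  submonoid_valP : submonoid_val \in S
}.

HB.instance Definition _ := [isSub for submonoid_val].
HB.instance Definition _ := [Choice of submonoid by <:].

Lemma submonoid_closed : monoid_closed S.
Proof. by split; [exact: gpred1 | exact: gpredM]. Qed.

HB.instance Definition _ :=
  SubChoice_isSubMonoid.Build M (fun x => x \in S) submonoid submonoid_closed.

End Submonoid.

Record InjMap (X : Type) := Build_InjMap {
  InjMap_fun :> X -> X;
  InjMap_injective : injective InjMap_fun
}.

Section InjMonoid.
Variable X : Type.
Implicit Types f g h : InjMap X.

HB.instance Definition _ := gen_eqMixin (InjMap X).
HB.instance Definition _ := gen_choiceMixin (InjMap X).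

Lemma InjMap_ext f g : (f : X -> X) = g -> f = g.
Proof.
case: f g => [f fi] [g gi] /= E; subst g.
by congr Build_InjMap; exact: Prop_irrelevance.
Qed.

Definition InjMap_one : InjMap X := Build_InjMap (@inj_id X).

(* Maps are written on the right: f * g is f followed by g. *)
Definition InjMap_mul f g : InjMap X :=
  Build_InjMap (inj_comp (@InjMap_injective _ g) (@InjMap_injective _ f)).

Lemma InjMap_mulA : associative InjMap_mul.
Proof. by move=> f g h; apply: InjMap_ext. Qed.

Lemma InjMap_mul1 : left_id InjMap_one InjMap_mul.
Proof. by move=> f; apply: InjMap_ext. Qed.

Lemma InjMap_mulr1 : right_id InjMap_one InjMap_mul.
Proof. by move=> f; apply: InjMap_ext. Qed.

HB.instance Definition _ :=
  isMonoid.Build (InjMap X) InjMap_mulA InjMap_mul1 InjMap_mulr1.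

Definition Sym : {pred InjMap X} := fun f => `[< bijective f >].

Definition BL : {pred InjMap X} := fun f => ~` range f #= [set: X].

Definition SymBL : {pred InjMap X} := [predU Sym & BL].

Lemma BL_mull f g : f \in BL -> (f * g)%g \in BL.
Proof.
rewrite -!topredE /= /BL => fB; rewrite card_eq_le; apply/andP; split.
  exact: card_leT.
apply: (@card_le_trans _ _ _ (g @` (~` range f))); last first.
  apply: subset_card_le => _ [x Nx <-] [y _ /= /(@InjMap_injective _ g) E].
  by apply: Nx; exists y.
rewrite -(card_le_eql fB) (card_le_eqr (B := ~` range f)) ?card_lexx //.
by apply: inj_card_eq => x y _ _; exact: InjMap_injective.
Qed.

Lemma BL_Sym f g : f \in Sym -> g \in BL -> (f * g)%g \in BL.
Proof.
rewrite -!topredE /= /BL => /asboolP[h _ fK].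
suff -> : range (f * g)%g = range g by [].
apply/seteqP; split=> [_ [x _ <-]|_ [x _ <-]]; first by exists (f x).
by exists (h x) => //=; rewrite fK.
Qed.

Lemma SymBL_mul1 : (1 : InjMap X)%g \in SymBL.
Proof. by apply/orP; left; apply/asboolP; exists id. Qed.

Lemma SymBL_mulM : mulg_closed SymBL.
Proof.
move=> f g /orP[fS|fB] /orP[gS|gB]; apply/orP; try by right; apply: BL_mull.
  by left; apply/asboolP; move: gS fS => /asboolP gS /asboolP; exact: bij_comp.
by right; apply: BL_Sym.
Qed.

HB.instance Definition _ := isMulClosed.Build (InjMap X) SymBL SymBL_mulM.
HB.instance Definition _ := isMul1Closed.Build (InjMap X) SymBL SymBL_mul1.

End InjMonoid.

Arguments Sym X : clear implicits.
Arguments BL X : clear implicits.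
Arguments SymBL X : clear implicits.

(* Main.v *)
Require Import Defs.
From HB Require Import structures.
From mathcomp Require Import all_boot all_order.
From mathcomp Require Import boolp classical_sets functions cardinality.

Set Implicit Arguments.
Unset Strict Implicit.
Unset Printing Implicit Defensive.

Local Open Scope classical_set_scope.
Local Open Scope card_scope.

(** Write maps on the right and call a subset of X large when X embeds in it,
so that a map is Baer-Levi exactly when the complement of its image is large.
Two facts about an infinite X carry everything: X contains countably
many disjoint copies of itself ([infinite_setX_nat]), and a union of two non-large
sets is not large ([large_setU], which rests on comparability of cardinals).

Finite generation forces a Baer-Levi element ([universal_fin_gen_BL]).  Think
of an element a of S as a labelling of the points of X.  In a step from [u * s] to
[v * s], the old label of x is the new label of y whenever [u x = v y], and if
no image has a large complement, this relates all but a small set of points x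
to some y.  Composing, a U-sequence from a to 1 yields a word w in the
generators whose relation sends x to [a x] for all but a small set of x.  There
are only countably many words, each giving a partial function, and one
permutation can disagree on a large set with each of countably many partial
functions: give every one of them its own block of size |X|, and on that block
be either the identity or a fixed-point-free involution, whichever disagrees.

One Baer-Levi element gives all of them: any two differ by a permutation
applied after them, since the complements of their images have the same size
([BL_Sym_orbit]).

Suppose now that S contains both Sym X and BL X.  For the upper bound, split X
as the disjoint union of the images of two injections f and g, and let U
consist of (1, f), (1, g) and (f, g).  As any two maps with disjoint images are
[f * s] and [g * s] for some s, a single step by (f, g) links two elements of
S with disjoint images whose union has a large complement.  Given a and b,
among the four pairs formed by one of f * a, g * a and one of f * b, g * b,
some pair leaves a large part of X uncovered; any c whose image is half of that
part yields the sequence a, f * a, c, f * b, b of length 4 (or its analogues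
with g).

For the lower bound ([diameter_ge4]), follow a sequence of length 3 from 1 to a
permutation b.  The first and last multipliers must be bijective, hence are
determined by the generators and by b; what is left is a single middle
multiplier s with [s (u x) = p x] and [s (v y) = b (q y)], where p, q, u, v
come from a countable list independent of b.  Such an s exists only if
[p x = b (q y)] is equivalent to [u x = v y], and a permutation b can violate
this for every item of the list at once, by exchanging or fixing one pair of
points chosen for that item. *)

(** * Cardinality *)

Lemma card_le_of_inj T U (A : set T) (B : set U) (f : T -> U) :
  set_fun A B f -> set_inj A f -> A #<= B.
Proof.
move=> fAB fI; have /injfunPex[g] : exists2 f : T -> U, set_fun A B f & set_inj A f.
  by exists f.
exact: inj_card_le g.
Qed.

(** The given function serves as a default outside A, which lets the codomain
be a plain type. *)
Lemma card_le_fun T U (A : set T) (B : set U) (f0 : T -> U) : A #<= B ->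
  exists f : T -> U, set_fun A B f /\ set_inj A f.
Proof.
move=> /card_leP[g].
pose h x := if pselect (A x) is left Ax then val (g (SigSub (mem_set Ax))) else f0 x.
exists h; split=> [x Ax|x y /set_mem Ax /set_mem Ay]; rewrite /h.
  by case: pselect => // Ax'; exact: set_valP.
case: pselect => // Ax'; case: pselect => // Ay' /val_inj.
move=> /(@inj _ _ _ g); rewrite !inE => /(_ I I).
by move=> /(congr1 val).
Qed.

(** Comparability of cardinals: a maximal graph of a partial injection from A
to B has full domain or full range, since otherwise one more pair could be
added. *)
Lemma card_le_total T U (A : set T) (B : set U) : A #<= B \/ B #<= A.
Proof.
pose P (G : set (T * U)) := [/\ forall p, G p -> A p.1 /\ B p.2,
  forall p q, G p -> G q -> p.1 = q.1 -> p.2 = q.2 &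
  forall p q, G p -> G q -> p.2 = q.2 -> p.1 = q.1].
have [F FP totF|G [[GAB Gf Gi] Gmax]] := @Zorn_bigcup _ P.
  have join p q C D : F C -> C p -> F D -> D q -> exists E, [/\ P E, E p & E q].
    move=> FC Cp FD Dq; have [CD|DC] := totF _ _ FC FD.
      by exists D; split=> //; [exact: FP|exact: CD].
    by exists C; split=> //; [exact: FP|exact: DC].
  split.
  - by move=> p [C FC Cp]; have [H _ _] := FP _ FC; exact: H.
  - move=> p q [C FC Cp] [D FD Dq].
    by have [E [[_ H _] Ep Eq]] := join _ _ _ _ FC Cp FD Dq; exact: H.
  - move=> p q [C FC Cp] [D FD Dq].
    by have [E [[_ _ H] Ep Eq]] := join _ _ _ _ FC Cp FD Dq; exact: H.
have [domA|/existsNP[a /not_implyP[Aa Na]]] :=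
    pselect (forall a, A a -> exists b, G (a, b)).
  have [[a0 Aa0]|A0] := pselect (A !=set0); last first.
    left; have -> : A = set0 by apply/seteqP; split=> // x Ax; apply: A0; exists x.
    exact: card_ge0.
  have [b0 _] := domA _ Aa0.
  have /choice[f fP] a : exists b, A a -> G (a, b).
    have [/domA[b Gb]|NA] := pselect (A a); first by exists b.
    by exists b0.
  left; apply: (@card_le_of_inj _ _ _ _ f) => [a /fP/GAB[]//|].
  move=> a a' /set_mem/fP Ga /set_mem/fP Ga' E.
  exact: Gi Ga Ga' E.
have [codB|/existsNP[b /not_implyP[Bb Nb]]] :=
    pselect (forall b, B b -> exists a, G (a, b)).
  have /choice[f fP] b : exists a, B b -> G (a, b).
    have [/codB[a' Ga]|NB] := pselect (B b); first by exists a'.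
    by exists a.
  right; apply: (@card_le_of_inj _ _ _ _ f) => [b /fP/GAB[]//|].
  move=> b b' /set_mem/fP Gb /set_mem/fP Gb' E.
  exact: Gf Gb Gb' E.
exfalso; apply: (Gmax (G `|` [set (a, b)])).
  split=> [p|/(_ (a, b))]; first by left.
  by move=> /(_ (or_intror erefl)) Gab; apply: Na; exists b.
split=> [p [/GAB//|->//]|p q|p q].
- move=> [Gp|->] [Gq|->] //=; first exact: Gf.
    by move=> E; case: Na; exists p.2; rewrite -E -surjective_pairing.
  by move=> E; case: Na; exists q.2; rewrite E -surjective_pairing.
- move=> [Gp|->] [Gq|->] //=; first exact: Gi.
    by move=> E; case: Nb; exists p.1; rewrite -E -surjective_pairing.
  by move=> E; case: Nb; exists q.1; rewrite E -surjective_pairing.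
Qed.

(** A maximal family of pairwise disjoint countably infinite subsets of A
covers A up to a finite remainder.  Its union D satisfies the claim block by
block, because it holds for [nat], and the remainder is absorbed into D. *)
Lemma infinite_setX_nat T (A : set T) :
  infinite_set A -> A `*` [set: nat] #<= A.
Proof.
move=> Ainf.
pose P (F : set (set T)) := (forall C, F C -> C `<=` A /\ C #= [set: nat]) /\
  (forall C D x, F C -> F D -> C x -> D x -> C = D).
have [F FP totF|F [[FA Fdisj] Fmax]] := @Zorn_bigcup _ P.
  split=> [C [G FG GC]|C D x [G FG GC] [H FH HD]].
    exact: (FP _ FG).1 _ GC.
  have [GH|HG] := totF _ _ FG FH.
    by apply: (FP _ FH).2 => //; exact: GH.
  by apply: (FP _ FG).2 => //; exact: HG.
pose D := \bigcup_(C in F) C.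
have DA : D `<=` A by move=> x [C /FA[CA _] /CA].
have [x0 _] := infinite_setN0 Ainf.
have ADfin : finite_set (A `\` D).
  apply/finite_setPn => /(card_le_fun (fun=> x0))[g [gAD gI]].
  have CD x : range g x -> D x -> False by move=> [n _ <-]; case: (gAD n I).
  apply: (Fmax (F `|` [set range g])).
    split=> [C|/(_ (range g) (or_intror erefl)) Fg]; first by left.
    by apply: (CD (g 0%N)); [exists 0%N|exists (range g) => //; exists 0%N].
  split=> [C [/FA//|->]|C C' x].
    split; first by move=> _ [n _ <-]; case: (gAD n I).
    by apply: inj_card_eq => m n _ _; apply: gI; rewrite in_setT.
  move=> [FC|->] [FC'|->] // Cx C'x; first exact: Fdisj Cx C'x.
    by case: (CD x) => //; exists C.
  by case: (CD x) => //; exists C'.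
have [d0 Dd0] : D !=set0.
  apply: contrapT => D0; apply: Ainf; apply: sub_finite_set ADfin => x Ax.
  by split=> // Dx; apply: D0; exists x.
have [k [kD kI]] : exists k : T * nat -> T,
    set_fun (D `*` [set: nat]) D k /\ set_inj (D `*` [set: nat]) k.
  have /choice[c cP] x : exists C, D x -> F C /\ C x.
    have [[C FC Cx]|ND] := pselect (D x); first by exists C.
    by exists D.
  have /choice[h hP] C : exists h : T * nat -> T, F C ->
      set_fun (C `*` [set: nat]) C h /\ set_inj (C `*` [set: nat]) h.
    have [/FA[_ CN]|NF] := pselect (F C); last by exists fst.
    move: CN; rewrite card_eq_le => /andP[CN NC].
    have [r [_ rI]] := card_le_fun (fun=> 0%N) CN.
    have [s [sC sI]] := card_le_fun (fun=> x0) NC.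
    exists (fun p => s (pickle (r p.1, p.2))) => _; split=> [p _|[x m] [y n]].
      exact: sC.
    move=> /set_mem[/= Cx _] /set_mem[/= Cy _] E.
    have := sI _ _ _ _ E; rewrite !in_setT => /(_ isT isT)/(pcan_inj pickleK)[rxy ->].
    by congr pair; apply: rI => //; apply/mem_set.
  exists (fun p => h (c p.1) p).
  have hD p : D p.1 -> c p.1 (h (c p.1) p).
    by move=> /cP[Fc cp]; apply: (hP _ Fc).1.
  split=> [p [Dp _]|p q /set_mem[Dp _] /set_mem[Dq _] E].
    by exists (c p.1); [case: (cP _ Dp)|exact: hD].
  have [Fp cp] := cP _ Dp; have [Fq cq] := cP _ Dq.
  have cpq : c p.1 = c q.1.
    by apply: (Fdisj _ _ _ Fp Fq (hD _ Dp)); rewrite E; exact: hD.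
  move: cq E; rewrite -cpq => cq E.
  by apply: (hP _ Fp).2 E; apply/mem_set.
have [e [_ eI]] := card_le_fun (fun=> 0%N) (finite_set_countable ADfin).
(* [phi] embeds A into D: the points of D go to level 0, and the remainder goes
   to the positive levels above the single point [d0]. *)
pose phi x := if pselect (D x) then k (x, 0%N) else k (d0, (e x).+1).
have phiD x : D (phi x) by rewrite /phi; case: pselect => Dx; apply: kD.
have phiI : set_inj A phi.
  move=> x y /set_mem Ax /set_mem Ay; rewrite /phi.
  case: pselect => Dx; case: pselect => Dy /kI;
    rewrite !mem_set //= => /(_ isT isT) // [] //.
  by move=> E; apply: eI => //; apply/mem_set.
apply: (@card_le_of_inj _ _ _ _ (fun p => k (phi p.1, p.2))) => [p _|].
  by apply/DA/kD; split=> //; exact: phiD.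
move=> [x m] [y n] /set_mem[/= Ax _] /set_mem[/= Ay _] /kI.
rewrite !mem_set //= => /(_ isT isT)[/phiI E ->].
by congr pair; apply: E; apply/mem_set.
Qed.

Lemma card_eq_fun T U (A : set T) (B : set U) (f0 : T -> U) : A #= B ->
  exists f : T -> U, set_bij A B f.
Proof.
move=> /card_bijP[g [g' gK g'K]].
pose h x := if pselect (A x) is left Ax then val (g (SigSub (mem_set Ax))) else f0 x.
have hE x (Ax : A x) : h x = val (g (SigSub (mem_set Ax))).
  rewrite /h; case: pselect => // Ax'; congr (val (g _)); exact: val_inj.
exists h; split=> [x Ax|x y /set_mem Ax /set_mem Ay|y By].
- by rewrite hE; exact: set_valP.
- by rewrite !hE => /val_inj/(can_inj gK)/(congr1 val).
- have Ax := set_valP (g' (SigSub (mem_set By))).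
  exists (val (g' (SigSub (mem_set By)))) => //.
  rewrite (hE _ Ax); set z := SigSub _.
  have -> : z = g' (SigSub (mem_set By)) by exact: val_inj.
  by rewrite g'K.
Qed.

(** * Large subsets *)

Section Large.
Variable X : Type.
Implicit Types A B : set X.

Definition large A := exists2 f : X -> X, injective f & forall x, A (f x).

Lemma largeP A : large A <-> [set: X] #<= A.
Proof.
split=> [[f fI fA]|/(card_le_fun id)[f [fA fI]]].
  by apply: (card_le_of_inj (f := f)) => [x _|x y _ _ /fI].
by exists f => [x y|x]; [apply: fI; rewrite in_setT|exact: fA].
Qed.

Lemma BL_largeP (f : InjMap X) : f \in BL X <-> large (~` range f).
Proof.
rewrite largeP -topredE /= /BL card_eq_le; split=> [/andP[]//|->].
by rewrite andbT card_leT.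
Qed.

Lemma largeS A B : A `<=` B -> large A -> large B.
Proof. by move=> AB [f fI fA]; exists f => // x; exact: AB. Qed.

(** Injectivity of the relation suffices: composing an embedding of X in A with
a choice of related points in B stays injective. *)
Lemma large_injrel A B (R : X -> X -> Prop) :
  (forall x x' y, R x y -> R x' y -> x = x') ->
  (forall x, A x -> exists2 y, R x y & B y) -> large A -> large B.
Proof.
move=> RI AB [f fI fA]; have /choice[g gP] x : exists y, R (f x) y /\ B y.
  by have [y Ry By] := AB _ (fA x); exists y.
exists g => [x y E|x]; last by case: (gP x).
by apply: fI; apply: (RI _ _ (g x)); [case: (gP x)|rewrite E; case: (gP y)].
Qed.

Hypothesis Xinf : infinite_set [set: X].

Lemma exists_inj_nat : exists e : X * nat -> X, injective e.
Proof.
have [e [_ eI]] := card_le_fun fst (infinite_setX_nat Xinf).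
by exists e => p q; apply: eI; rewrite mem_set.
Qed.

Lemma exists_bij_bool : exists e : X * bool -> X, bijective e.
Proof.
have [e eI] := exists_inj_nat.
have : [set: X * bool] #= [set: X].
  apply: Cantor_Bernstein.
    apply: (card_le_of_inj (f := fun p => e (p.1, nat_of_bool p.2))) => //.
    by move=> [x b] [y c] _ _ /eI[-> /=]; case: b c => [] [].
  by apply: (card_le_of_inj (f := fun x => (x, true))) => // x y _ _ [].
by move=> /(card_eq_fun fst)[h]; rewrite setTT_bijective; exists h.
Qed.

(** If |A| <= |B| then the union embeds in two disjoint copies of B, hence in
B times [nat], hence in B. *)
Lemma large_setU A B : large (A `|` B) -> large A \/ large B.
Proof.
suff half C D : C #<= D -> large (C `|` D) -> large D.
  move=> AB; have [le|le] := card_le_total A B; first by right; exact: half AB.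
  by left; apply: half le _; rewrite setUC.
move=> CD CDl; have [f fI fCD] := CDl.
have [h [hD hI]] := card_le_fun id CD.
have Dinf : infinite_set D.
  move=> Dfin; apply: Xinf; apply: (card_le_finite _ (B := C `|` D)).
    exact/largeP.
  by rewrite finite_setU; split=> //; apply: card_le_finite Dfin.
have [k [kD kI]] := card_le_fun fst (infinite_setX_nat Dinf).
pose g x := if pselect (D (f x)) then k (f x, 0%N) else k (h (f x), 1%N).
have hfD x : ~ D (f x) -> D (h (f x)).
  by move=> nD; apply: hD; case: (fCD x).
exists g => [x y|x]; rewrite /g.
  case: pselect => Dx; case: pselect => Dy /kI; rewrite !mem_set /=;
    try by split=> //; exact: hfD.
  - by move=> /(_ isT isT)[/fI].
  - by move=> /(_ isT isT)[].
  - by move=> /(_ isT isT)[].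
  - move=> /(_ isT isT)[/hI E]; apply/fI/E; apply/mem_set.
      by case: (fCD x).
    by case: (fCD y).
case: pselect => Dx; apply: kD; split=> //=; exact: hfD.
Qed.

End Large.

(** * Diagonal constructions of permutations *)

(** Indices k stand for disjoint pairs of points [e (k, false)], [e (k, true)];
[p] exchanges the two points of each pair in J and fixes the other pairs. *)
Lemma exists_exchange (K X : Type) (e : K * bool -> X) (J : set K) :
  injective e -> exists2 p : X -> X, involutive p &
    forall k b, p (e (k, b)) = e (k, b (+) `[< J k >]).
Proof.
move=> eI; pose e' k b := e (k, b (+) `[< J k >]).
have /choice[p pP] x : exists y, (forall k b, x = e (k, b) -> y = e' k b) /\
    ((forall kb, x <> e kb) -> y = x).
  have [[[k b] ->]|/forallNP xe] := pselect (exists kb, x = e kb).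
    by exists (e' k b); split=> [k' b' /eI[-> ->] //|/(_ (k, b))].
  by exists x; split=> // k b /xe.
have pE k b : p (e (k, b)) = e' k b by apply: (pP _).1.
exists p => // x; have [[[k b] ->]|/forallNP xe] := pselect (exists kb, x = e kb).
  by rewrite pE pE /e' addbK.
by have px := (pP x).2 xe; rewrite !px.
Qed.

(** The i-th relation gets its own block of size |X|, on which [p] is the
identity if the relation misses a large part of the diagonal there, and
exchanges points in pairs otherwise.  In the second case the relation, being
functional, must miss [(x, p x)] wherever it contains [(x, x)]. *)
Lemma exists_perm_escaping X (W : nat -> X -> X -> Prop) :
  infinite_set [set: X] ->
  (forall i x y z, W i x y -> W i x z -> y = z) ->
  exists2 p : X -> X, involutive p & forall i, large [set x | ~ W i x (p x)].
Proof.
move=> Xinf Wf; have [e eI] := exists_inj_nat Xinf.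
have [d dbij] := exists_bij_bool Xinf.
pose block i : set X := [set e (z, i) | z in [set: X]].
pose offdiag i := block i `&` [set x | ~ W i x x].
pose J : set (X * nat) := [set k | ~ large (offdiag k.2)].
have [|p pK pE] := @exists_exchange _ _ (fun kb => e (d (kb.1.1, kb.2), kb.1.2)) J.
  by move=> [[x i] b] [[y j] c] /eI[/(bij_inj dbij)[-> ->] ->].
exists p => // i.
have pblock x : block i x -> if `[< large (offdiag i) >] then p x = x else p x <> x.
  move=> [z _ <-]; have [d' _ d'K] := dbij.
  rewrite -(d'K z); case: (d' z) => y b; have := pE (y, i) b; rewrite /J /=.
  rewrite asbool_neg; case: asboolP => _ ->; rewrite /= ?addbF // addbT.
  by move=> /eI[/(bij_inj dbij)[]]; case: (b).
have [mi|nmi] := pselect (large (offdiag i)).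
  apply: largeS (mi) => x [bx nW] /=.
  by move: (pblock _ bx); case: asboolP => // _ ->.
have : large (offdiag i `|` [set x | ~ W i x (p x)]).
  exists (fun z => e (z, i)) => [x y /eI[]//|z].
  have bz : block i (e (z, i)) by exists z.
  have [Wz|nWz] := pselect (W i (e (z, i)) (e (z, i))); last by left.
  right=> /= Wp; have := pblock _ bz; case: asboolP => // _; apply.
  exact: Wf Wp Wz.
by move=> /(large_setU Xinf)[].
Qed.

(** Greedy choice: at each stage only finitely many points are taken. *)
Lemma exists_distinct_representatives X (A : nat -> set X) :
  (forall k, infinite_set (A k)) ->
  exists2 s : nat -> X, injective s & forall k, A k (s k).
Proof.
move=> Ainf.
have /choice[c cP] (kF : nat * set X) : exists x,
    finite_set kF.2 -> A kF.1 x /\ ~ kF.2 x.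
  have [Ffin|NF] := pselect (finite_set kF.2).
    have [x [Ax NFx]] := infinite_setN0 (infinite_setD (Ainf kF.1) Ffin).
    by exists x.
  by have [x _] := infinite_setN0 (Ainf 0%N); exists x.
pose fix used k : set X := if k is m.+1 then used m `|` [set c (m, used m)] else set0.
have usedfin k : finite_set (used k).
  by elim: k => [|k IH] /=; rewrite ?finite_setU.
exists (fun k => c (k, used k)) => [|k]; last by case: (cP (k, used k) (usedfin k)).
suff lt j k : (j < k)%N -> c (j, used j) <> c (k, used k).
  move=> j k E; case: (ltngtP j k) => // /lt; last by rewrite E.
  by rewrite E.
move=> jk E; have [_] := cP (k, used k) (usedfin k); apply; rewrite /= -E.
elim: k jk {E} => // k IH; rewrite ltnS leq_eqVlt => /orP[/eqP->|/IH]; first by right.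
by left.
Qed.

(** A mediating injection s makes [b (q i y) = p i x] equivalent to
[u i x = v i y].  For each i fix x and y such that all the points [q i y] and
[p i x] are distinct; then exchanging these two points when [u i x <> v i y],
and fixing them otherwise, breaks the equivalence for every i at once. *)
Lemma exists_perm_unmediated X (p q u v : nat -> X -> X) :
  infinite_set [set: X] ->
  (forall i, injective (p i)) -> (forall i, injective (q i)) ->
  exists2 b : X -> X, involutive b & forall i (s : X -> X), injective s ->
    (forall x, s (u i x) = p i x) -> (forall y, s (v i y) = b (q i y)) -> False.
Proof.
move=> Xinf pI qI.
have rinf (f : X -> X) : injective f -> infinite_set (range f).
  move=> fI; apply: contra_not Xinf; apply: card_le_finite.
  by apply: (card_le_of_inj (f := f)) => [x _|x y _ _ /fI]; first by exists x.
(* Even indices choose the points [q i y], odd ones the points [p i x]. *)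
pose A n := if odd n then range (p n./2) else range (q n./2).
have [|s sI sA] := @exists_distinct_representatives _ A.
  by move=> n; rewrite /A; case: odd; exact: rinf.
have /choice[y yE] i : exists y, q i y = s i.*2.
  by have := sA i.*2; rewrite /A odd_double doubleK => -[y _ yE]; exists y.
have /choice[x xE] i : exists x, p i x = s i.*2.+1.
  by have := sA i.*2.+1; rewrite /A /= odd_double /= uphalf_double => -[x _ xE]; exists x.
have [|b bK bE] := @exists_exchange _ _ (fun ib => s (ib.2 + ib.1.*2)%N)
    [set i | u i (x i) <> v i (y i)].
  move=> [i c] [j d] /sI /= E; have cd : c = d.
    by move: (congr1 odd E); rewrite !oddD !odd_double !addbF !oddb.
  by move: E; rewrite cd => /addnI/double_inj->.
exists b => // i t tI tp tq.
have := bE i false; have := tq (y i); rewrite yE add0n => <-.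
case: asboolP => /= [ne E|/contrapT <-].
  by apply: ne; apply: tI; rewrite E tp xE.
by rewrite tp xE => /sI/eqP; rewrite (gtn_eqF (ltnSn _)).
Qed.

(** * Injective maps and their images *)

Section InjectiveMaps.
Variable X : Type.
Hypothesis Xinf : infinite_set [set: X].

(** The permutation is forced on the image of f; on the complement it may be
any bijection onto the complement of the image of g, and both complements have
the size of X. *)
Lemma BL_Sym_orbit (f g : InjMap X) : f \in BL X -> g \in BL X ->
  exists2 h, h \in Sym X & (f * h)%g = g.
Proof.
rewrite -!topredE /= /BL => fB gB.
have [k [kg kI kS]] := card_eq_fun id (card_eq_trans fB (card_esym gB)).
have /choice[h hP] y : exists z, (forall x, y = f x -> z = g x) /\
    (~ range f y -> z = k y).
  have [[x _ <-]|Ny] := pselect (range f y).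
    exists (g x); split=> [x' /(@InjMap_injective _ f)->//|[]]; by exists x.
  by exists (k y); split=> // x E; case: Ny; exists x.
have hf x : h (f x) = g x by apply: (hP _).1.
have hk y : ~ range f y -> h y = k y by apply: (hP _).2.
have hbij : bijective h.
  rewrite -setTT_bijective; split=> // [y z _ _|z _].
    have [[x _ <-]|Ny] := pselect (range f y); have [[x' _ <-]|Nz] := pselect (range f z).
    - by rewrite !hf => /(@InjMap_injective _ g)->.
    - by rewrite hf hk // => E; case: (kg _ Nz); rewrite -E; exists x.
    - by rewrite hf hk // => E; case: (kg _ Ny); rewrite E; exists x'.
    - by rewrite !hk //; apply: kI; apply/mem_set.
  have [[x _ <-]|Nz] := pselect (range g z); first by exists (f x).
  by have [y Ny <-] := kS _ Nz; exists y => //; rewrite hk.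
exists (Build_InjMap (bij_inj hbij)); first exact/asboolP.
by apply: InjMap_ext; apply/funext => x; rewrite /= hf.
Qed.

(** This holds when X is the disjoint union of the images of f and g.  It is
stated by its consequence, that two maps with disjoint images have a common
right factor through f and g, because this is how a generator (f, g) is used:
[f * s = a] and [g * s = b] make it link a and b in one step.  The bound on
the image of s keeps s Baer-Levi when the two images leave a large part of X
uncovered. *)
Definition tiling (f g : InjMap X) : Prop :=
  (forall x y, f x <> g y) /\
  forall a b : InjMap X, (forall x y, a x <> b y) ->
    exists s : InjMap X, [/\ (f * s)%g = a, (g * s)%g = b &
      range s `<=` range a `|` range b].

Lemma exists_tiling : exists f g, [/\ tiling f g, f \in BL X & g \in BL X].
Proof.
have [e [e' eK e'K]] := exists_bij_bool Xinf.
have tI c : injective (fun x => e (x, c)) by move=> x y /(can_inj eK)[].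
exists (Build_InjMap (tI false)), (Build_InjMap (tI true)); split.
- split=> [x y /(can_inj eK)//|a b ab].
  pose s z := if (e' z).2 then b (e' z).1 else a (e' z).1.
  have sI : injective s.
    move=> y z; rewrite /s => syz; apply: (can_inj e'K); move: syz.
    case: (e' y) (e' z) => [y0 []] [z0 []] /=.
    + by move=> /(@InjMap_injective _ b)->.
    + by move=> /esym/ab.
    + by move=> /ab.
    + by move=> /(@InjMap_injective _ a)->.
  exists (Build_InjMap sI); split.
  + by apply: InjMap_ext; apply/funext => x; rewrite /= /s eK.
  + by apply: InjMap_ext; apply/funext => x; rewrite /= /s eK.
  + by move=> _ [z _ <-]; rewrite /= /s; case: (e' z).2; [right|left]; exists (e' z).1.
- apply/BL_largeP; exists (fun x => e (x, true)) => // x [y _ /(can_inj eK)//].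
- apply/BL_largeP; exists (fun x => e (x, false)) => // x [y _ /(can_inj eK)//].
Qed.

Lemma large_halve (A : set X) : large A ->
  exists f : InjMap X, range f `<=` A /\ large (A `\` range f).
Proof.
move=> [h hI hA]; have [e [e' eK _]] := exists_bij_bool Xinf.
have tI c : injective (fun x => h (e (x, c))) by move=> x y /hI/(can_inj eK)[].
exists (Build_InjMap (tI false)); split; first by move=> _ [x _ <-]; exact: hA.
exists (fun x => h (e (x, true))) => // x; split=> // -[y _ /hI/(can_inj eK)//].
Qed.

(** A point cannot lie in the images of both f * a and g * a, nor of both f * b
and g * b, so each point of X is missed by at least one of the four pairs;
hence one pair misses a large set. *)
Lemma tiling_avoid (f g a b : InjMap X) : (forall x y, f x <> g y) ->
  exists f' g', [/\ f' = f \/ f' = g, g' = f \/ g' = g &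
    large (~` (range (f' * a)%g `|` range (g' * b)%g))].
Proof.
move=> fg; pose R f' g' := ~` (range (f' * a)%g `|` range (g' * b)%g).
suff : large ((R f f `|` R f g) `|` (R g f `|` R g g)).
  by case/(large_setU Xinf) => /(large_setU Xinf)[]; [exists f, f|exists f, g
    |exists g, f|exists g, g]; split=> //; [left|left|left|right|right|left|right|right].
have disj (c : InjMap X) y : range (f * c)%g y -> ~ range (g * c)%g y.
  by move=> [x _ <-] [x' _ /(@InjMap_injective _ c)/esym/fg].
exists id => // y; rewrite /R.
have [ia|ia] := pselect (range (f * a)%g y);
  have [ib|ib] := pselect (range (f * b)%g y).
- by right; right; case; [exact: disj ia|exact: disj ib].
- by right; left; case=> //; exact: disj ia.
- by left; right; case=> //; exact: disj ib.
- by left; left; case.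
Qed.

(** In effect [p] is v followed by the inverse of u; when u is not bijective
any injective map will do. *)
Lemma exists_quotient (u v : X -> X) : injective v ->
  exists p : X -> X, injective p /\ (bijective u -> forall x, u (p x) = v x).
Proof.
move=> vI; have [[u' uK u'K]|Nu] := pselect (bijective u); last by exists id; split=> // /Nu.
by exists (u' \o v); split=> [|_ x /=]; [exact: inj_comp (can_inj u'K) vI|rewrite u'K].
Qed.

End InjectiveMaps.

(** * Sequences of generators *)

Section Sequences.
Variables (S : semigroupType) (U : set (S * S)).
Implicit Types a b c : S.

Lemma ustep_sym a b : ustep U a b -> ustep U b a.
Proof.
by move=> [u [v [s [uv -> <-]]]]; exists v, u, s; split=> //; rewrite or_comm.
Qed.

Lemma ustep_mulr a b s : ustep U a b -> ustep U (a * s)%g (b * s)%g.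
Proof.
move=> [u [v [[t|] [uv -> <-]]]]; exists u, v.
  by exists (Some (t * s)%g); split=> //=; rewrite mulgA.
by exists (Some s).
Qed.

Lemma useq_cat m n a b c : useq U m a b -> useq U n b c -> useq U (m + n) a c.
Proof.
elim: m a => [a -> //|m IH a [d [ad db]] bc].
by exists d; split=> //; exact: IH.
Qed.

Lemma useq_sym n a b : useq U n a b -> useq U n b a.
Proof.
elim: n a => // n IH a [d [/ustep_sym da /IH bd]].
by rewrite -addn1; apply: useq_cat bd _; exists a.
Qed.

Lemma useq_mulr n a b s : useq U n a b -> useq U n (a * s)%g (b * s)%g.
Proof.
elim: n a => [a -> //|n IH a [d [ad /IH db]]].
by exists (d * s)%g; split=> //; exact: ustep_mulr.
Qed.

Lemma right_congruence_genE a b :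
  right_congruence_gen U a b <-> exists n, useq U n a b.
Proof.
split=> [/(_ (fun c d => exists n, useq U n c d))|[n]].
  apply; last by move=> u v Uuv; exists 1, v; split=> //; exists u, v, None; split=> //; left.
  split; last by move=> c d s [n cd]; exists n; exact: useq_mulr.
  split; first by move=> c; exists 0.
    by move=> c d [n cd]; exists n; exact: useq_sym.
  by move=> c d e [m cd] [n de]; exists (m + n)%N; exact: useq_cat de.
elim: n a => [a -> rho [[]]//|n IH a [c [[u [v [s [uv -> <-]]]] /IH cb]]] rho rhoC rhoU.
have [[rhoR rhoS rhoT] rhoM] := rhoC.
apply: rhoT (cb _ rhoC rhoU).
have rhouv : rho u v by case: uv => /rhoU // /rhoS.
by case: s {cb} => [s|//]; exact: rhoM.
Qed.

Lemma useq_ex_dist n a b : useq U n a b -> exists2 k, k <= n & right_dist U a b k.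
Proof.
move=> ab; have exP : exists k, `[< useq U k a b >] by exists n; exact/asboolP.
have kmin := ex_minnP exP; case: kmin => k /asboolP abk kmin.
exists k; first by apply: kmin; apply/asboolP.
by split=> // j /= abj; rewrite leEnat; apply: kmin; apply/asboolP.
Qed.

End Sequences.

(** Adjoining the pair (1, 1) allows idle steps, so that sequences of length at
most n can be treated as having length exactly n. *)
Lemma useq_pad (M : monoidType) (U : set (M * M)) m n a b :
  m <= n -> useq U m a b -> useq (U `|` [set (1%g, 1%g)]) n a b.
Proof.
move=> mn; have {mn} -> : n = (m + (n - m))%N by rewrite subnKC.
move: (n - m) => {}n ab; apply: (useq_cat (b := b)).
  elim: m a ab => // m IH a [c [[u [v [s [uv ac cv]]]] /IH cb]].
  exists c; split=> //; exists u, v, s; split=> //.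
  by case: uv; [left|right]; left.
elim: n => // n IH; exists b; split=> //; exists 1%g, 1%g, (Some b).
by split; rewrite /= ?mul1g //; left; right.
Qed.

(** Oriented generators as a sequence indexed by [nat]: tuples and words of
generators then become tuples and words of integers, which are countable. *)
Lemma ustep_letters (M : monoidType) (U : set (M * M)) : finite_set U ->
  exists l : nat -> M * M, forall a b, ustep U a b ->
    exists i s, a = ((l i).1 * s)%g /\ ((l i).2 * s)%g = b.
Proof.
move=> /finite_seqP[L ->]; pose L' := L ++ [seq (p.2, p.1) | p <- L].
exists (nth (1%g, 1%g) L') => a b [u [v [s [uv au vb]]]].
have /(nthP (1%g, 1%g))[i _ iE] : (u, v) \in L'.
  rewrite mem_cat; case: uv => /= [->//|vu]; apply/orP; right.
  by apply/mapP; exists (v, u).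
exists i; rewrite iE; case: s au vb => [s|] /= au vb; first by exists s.
by exists 1%g; rewrite !mulg1.
Qed.

(** * Finite generation forces a Baer-Levi element *)

Section Follow.
Variable X : Type.

(** The partial injection v^-1 after u, composed along the letters (u, v) of w
and encoded as a relation. *)
Fixpoint follow (w : seq (InjMap X * InjMap X)) (x z : X) : Prop :=
  if w is (u, v) :: w' then exists2 y, u x = v y & follow w' y z else x = z.

Lemma follow_functional w x y z : follow w x y -> follow w x z -> y = z.
Proof.
elim: w x => [x <- //|[u v] w IH x [t uvt ty] [t' uvt' t'z]].
have tt' : t = t' by apply: (@InjMap_injective _ v); rewrite -uvt.
by apply: IH ty _; rewrite tt'.
Qed.

End Follow.

(** The monoid is given with an embedding [phi] in [InjMap X], so that the
results below apply both to a submonoid and to [InjMap X] itself. *)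
Section Embedding.
Variables (X : Type) (M : monoidType) (phi : M -> InjMap X).
Hypothesis Xinf : infinite_set [set: X].
Hypothesis phiI : injective phi.
Hypothesis phi1 : phi 1%g = 1%g.
Hypothesis phiM : forall a b, phi (a * b)%g = (phi a * phi b)%g.
Hypothesis SymM : forall f, f \in Sym X -> exists m, phi m = f.

Let involution_lift (p : X -> X) : involutive p ->
  exists m, forall x, phi m x = p x.
Proof.
move=> pK; have [|m mE] := SymM (f := Build_InjMap (inv_inj pK)).
  by apply/asboolP; exists p.
by exists m => x; rewrite mE.
Qed.

(** One step from [u * s] to [v * s] equates the values at x and y whenever
[u x = v y], and such a y exists unless [u x] lies outside the image of v.
This is a small set of exceptions when no element is Baer-Levi, and small sets
are closed under finite unions and under preimages by injective relations. *)
Lemma useq_almost_follow (U : set (M * M)) (l : nat -> M * M) :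
  (forall m, ~ large (~` range (phi m))) ->
  (forall a b, ustep U a b ->
    exists i s, a = ((l i).1 * s)%g /\ ((l i).2 * s)%g = b) ->
  forall n a b, useq U n a b -> exists w : seq nat,
    ~ large [set x | ~ exists2 y,
        follow [seq (phi (l i).1, phi (l i).2) | i <- w] x y & phi a x = phi b y].
Proof.
move=> noBL lP; elim=> [a b ->|n IH a b [c [/lP[i [s [-> <-]]] /IH[w wP]]]].
  exists [::] => -[f fI /(_ _) fE].
  have [x _] := infinite_setN0 Xinf.
  by apply: (fE x); exists (f x).
exists (i :: w) => Lbad.
pose miss : set X := [set x | ~ exists y, phi (l i).1 x = phi (l i).2 y].
pose bad : set X := [set x | ~ exists2 y,
  follow [seq (phi (l i).1, phi (l i).2) | i <- w] x y &
  phi ((l i).2 * s)%g x = phi b y].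
have : large (miss `|` [set x | exists2 y, phi (l i).1 x = phi (l i).2 y & bad y]).
  apply: largeS Lbad => x nx.
  have [[y xy]|nex] := pselect (exists y, phi (l i).1 x = phi (l i).2 y); last by left.
  right; exists y => // -[z wz yz]; apply: nx; exists z; first by exists y.
  by rewrite -yz !phiM /= xy.
case/(large_setU Xinf).
  move=> Lm; apply: (noBL (l i).2).
  apply: (large_injrel (R := fun x y => phi (l i).1 x = y)) Lm => [x x' y <-|x mx].
    by move=> /(@InjMap_injective _ (phi (l i).1)).
  by exists (phi (l i).1 x) => // -[y _ yx]; apply: mx; exists y.
move=> Lb; apply: wP.
apply: (large_injrel (R := fun x y => phi (l i).1 x = phi (l i).2 y)) Lb => // x x' y.
by move=> <- /(@InjMap_injective _ (phi (l i).1)).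
Qed.

(** A sequence from m to 1 makes m agree, up to a small set, with one of
countably many partial functions; the permutation that escapes all of them
is therefore not related to 1. *)
Lemma universal_fin_gen_BL : universal_fin_gen M -> exists m, phi m \in BL X.
Proof.
move=> [U [Ufin Ugen]]; apply: contrapT => /forallNP noBL.
have [l lP] := ustep_letters Ufin.
pose W n := follow [seq (phi (l i).1, phi (l i).2) | i <- odflt [::] (unpickle n)].
have [p pK pW] := @exists_perm_escaping _ W Xinf (fun n => @follow_functional _ _).
have [m mE] := involution_lift pK.
have /right_congruence_genE[n mn] := Ugen m 1%g.
have [|w] := useq_almost_follow _ lP mn.
  by move=> k /BL_largeP; exact: noBL.
apply; apply: largeS (pW (pickle w)) => x nW [y wy yE]; apply: nW.
by rewrite /W pickleK /= -mE yE phi1.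
Qed.

(** * The diameter in the presence of all Baer-Levi maps *)

Hypothesis BLM : forall f, f \in BL X -> exists m, phi m = f.

Let phi_mulE a b x : phi (a * b)%g x = phi b (phi a x).
Proof. by rewrite phiM. Qed.

Lemma ustep_tiling (U : set (M * M)) u v a b : U (u, v) \/ U (v, u) ->
  tiling (phi u) (phi v) -> (forall x y, phi a x <> phi b y) ->
  large (~` (range (phi a) `|` range (phi b))) -> ustep U a b.
Proof.
move=> uv [_ tuv] ab co; have [s [us vs sab]] := tuv _ _ ab.
have [|t ts] := BLM (f := s).
  by apply/BL_largeP; apply: largeS co => x; exact: contra_not (@sab x).
by exists u, v, (Some t); split=> //=; apply: phiI; rewrite phiM ts.
Qed.

Lemma exists_generators_4 : exists U : set (M * M), finite_set U /\
  forall a b, useq U 4 a b.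
Proof.
have [f [g [fg /BLM[F Ff] /BLM[G Gg]]]] := exists_tiling Xinf.
rewrite -{}Ff -{}Gg in fg.
pose U : set (M * M) := [set (1%g, F)] `|` [set (1%g, G)] `|` [set (F, G)].
exists U; split=> [|a b]; first by rewrite /U !finite_setU.
have pull m h : h = phi F \/ h = phi G -> exists2 m', ustep U m m' & phi m' = (h * phi m)%g.
  move=> hFG; have [k hk Uk] : exists2 k, phi k = h & U (1%g, k).
    by case: hFG => ->; [exists F|exists G] => //; left; [left|right].
  exists (k * m)%g; last by rewrite phiM hk.
  by exists 1%g, k, (Some m); split=> //=; [left|rewrite mul1g].
have [f' [g' [f'E g'E]]] := tiling_avoid Xinf (phi a) (phi b) fg.1.
have [a' aa' <-] := pull a _ f'E; have [b' bb' <-] := pull b _ g'E.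
move=> /large_halve-/(_ Xinf)[c [cab co]].
have [|m mc] := BLM (f := c).
  by apply/BL_largeP; apply: largeS co => x [].
(* [c] takes one half of the part of X missed by [a'] and [b'], and the other
   half keeps the multiplier Baer-Levi. *)
have join d : (forall x, range (phi d) x -> range (phi a') x \/ range (phi b') x) ->
    ustep U d m.
  move=> dab; apply: (ustep_tiling (or_introl _) fg); first by right.
    move=> x y E; case: (cab (phi m y)); first by rewrite mc; exists y.
    by rewrite -E; apply: dab; exists x.
  by rewrite mc; apply: largeS co => x [nab nc] [/dab|].
exists a'; split=> //; exists m; split; first by apply: join; left.
exists b'; split; first by apply/ustep_sym/join; right.
by exists b; split=> //; exact: ustep_sym.
Qed.

(** In a sequence of length 3 from 1 to a permutation, the two outer multipliers
are invertible and can be eliminated, which leaves the mediation problem that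
[exists_perm_unmediated] makes unsolvable. *)
Lemma diameter_ge4 (U : set (M * M)) n : finite_set U -> generates_universal U ->
  ubound [set k | exists a b, right_dist U a b k] n -> 4 <= n.
Proof.
move=> Ufin Ugen Un; rewrite leqNgt; apply/negP; rewrite ltnS => n3.
pose V := U `|` [set (1%g, 1%g)].
have [|l lP] := @ustep_letters _ V; first by rewrite finite_setU.
have /choice[P PP] (uv : (X -> X) * InjMap X) : exists p : X -> X,
  injective p /\ (bijective uv.1 -> forall x, uv.1 (p x) = uv.2 x).
  exact/exists_quotient/(@InjMap_injective _ uv.2).
(* [L] decodes an integer into the three letters of a sequence; [p] and [q] are
   the maps left over from the first and the third letter once the outer
   multipliers are eliminated. *)
pose L (n : nat) := odflt (0, 0, 0) (unpickle n).
pose p n := P (phi (l (L n).1.1).1 : X -> X, phi (l (L n).1.1).2).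
pose q n := P (phi (l (L n).2).2 : X -> X, phi (l (L n).2).1).
have [|i|b bK bP] := @exists_perm_unmediated _ p q
  (fun n => phi (l (L n).1.2).1) (fun n => phi (l (L n).1.2).2) Xinf.
- by move=> i; case: (PP (phi (l (L i).1.1).1 : X -> X, phi (l (L i).1.1).2)).
- by case: (PP (phi (l (L i).2).2 : X -> X, phi (l (L i).2).1)).
have [m mE] := involution_lift bK.
have /right_congruence_genE[j /useq_ex_dist[k _ kdist]] := Ugen 1%g m.
have k3 : k <= 3.
  by apply: leq_trans n3; rewrite -leEnat; apply: Un; exists 1%g, m.
have := useq_pad k3 kdist.1.
move=> [_ [/lP[i1 [s1 [e1 <-]]] [_ [/lP[i2 [s2 [e2 <-]]] [c [/lP[i3 [s3 [e3 s3m]]] mm]]]]]].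
rewrite mm in s3m.
pose N := pickle (i1, i2, i3).
have LN : L N = (i1, i2, i3) by rewrite /L pickleK.
(* [E1] and [E4] make [s1] and [s3] invertible, with inverses given by the
   first and the last letter. *)
have E1 x : phi s1 (phi (l i1).1 x) = x by rewrite -phi_mulE -e1 phi1.
have E2 x : phi s1 (phi (l i1).2 x) = phi s2 (phi (l i2).1 x) by rewrite -!phi_mulE e2.
have E3 x : phi s2 (phi (l i2).2 x) = phi s3 (phi (l i3).1 x) by rewrite -!phi_mulE e3.
have E4 x : phi s3 (phi (l i3).2 x) = b x by rewrite -phi_mulE s3m mE.
have bij1 : bijective (phi (l i1).1).
  by exists (phi s1) => // y; apply: (@InjMap_injective _ (phi s1)); rewrite E1.
have bij3 : bijective (phi (l i3).2).
  exists (b \o phi s3) => y /=; first by rewrite E4 bK.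
  by apply: (@InjMap_injective _ (phi s3)); rewrite E4 bK.
have pE x : phi (l i1).1 (p N x) = phi (l i1).2 x.
  by rewrite /p LN; exact: (PP (_, _)).2.
have qE y : phi (l i3).2 (q N y) = phi (l i3).1 y.
  by rewrite /q LN; exact: (PP (_, _)).2.
apply: (bP N (phi s2)) => [|x|y]; first exact: InjMap_injective.
  by rewrite LN -E2 -pE E1.
by rewrite LN E3 -E4 qE.
Qed.

Lemma has_right_diameter_4 : has_right_diameter M 4.
Proof.
have [U [Ufin U4]] := exists_generators_4.
have Ugen : generates_universal U.
  by move=> a b; apply/right_congruence_genE; exists 4.
split; first by exists U.
split=> [|k [V [Vfin Vgen [Vk _]]]]; last exact: diameter_ge4 Vk.
exists U; split=> //; split=> [k [a [b [_ kmin]]]|k]; first exact/kmin/U4.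
exact: diameter_ge4.
Qed.

End Embedding.

Theorem theorem3p17 (X : Type) (Xinf : infinite_set [set: X]) :
  (forall S : umagmaClosed (InjMap X), {subset Sym X <= S} ->
    [<-> universal_fin_gen (submonoid S) /\ right_diameter (submonoid S) 4;
         universal_fin_gen (submonoid S);
         exists a : InjMap X, a \in S /\ a \in BL X;
         {subset BL X <= S}]) /\
  has_right_diameter (submonoid (SymBL X)) 4 /\
  has_right_diameter (InjMap X) 4.
Proof.
have lift (S : umagmaClosed (InjMap X)) f :
    f \in S -> exists m : submonoid S, submonoid_val m = f.
  by move=> fS; exists (Submonoid fS).
have diam4 (S : umagmaClosed (InjMap X)) : {subset Sym X <= S} ->
    {subset BL X <= S} -> has_right_diameter (submonoid S) 4.
  move=> SymS BLS; apply: (has_right_diameter_4 (phi := @submonoid_val _ S)) => //.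
  - exact: val_inj.
  - by move=> f /SymS/lift.
  - by move=> f /BLS/lift.
split; [|split].
- move=> S SymS; tfae.
  + by case.
  + move=> fg; have [|m mB] := universal_fin_gen_BL (phi := @submonoid_val _ S) Xinf
      erefl (fun _ _ => erefl) _ fg; first by move=> f /SymS/lift.
    by exists (submonoid_val m); split=> //; exact: submonoid_valP.
  + move=> [a [aS aB]] f fB; have [h hS <-] := BL_Sym_orbit aB fB.
    by apply: gpredM => //; exact: SymS.
  + exact: diam4.
- by apply: diam4 => f fS; apply/orP; [left|right].
- by apply: (has_right_diameter_4 (phi := id)) => // f _; exists f.
Qed.
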